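(* Let $p$ be an odd prime and $m\ge1$. Then $$\Psi^w_{\mathbb{Z}_{p^m}}(x)=\frac{2}{p^{m-1}(p-1)}\sum_{d\mid\frac{\phi(p^m)}{2}}\phi\!\left(\frac{\phi(p^m)}{2d}\right)\left(\left(1+x^{\frac{\phi(p^m)}{d}}\right)^{d}-1\right)\prod_{k=1}^{m-1}\left(1+x^{\frac{\phi(p^{m-k})}{g_k(d)}}\right)^{g_k(d)},$$ where $g_k(d)=\gcd\!\left(d,\frac{\phi(p^{m-k})}{2}\right)$; hence $$\mathcal{E}^w(\mathbb{Z}_{p^m})=\Psi^w_{\mathbb{Z}_{p^m}}(1)=\frac{2}{p^{m-1}(p-1)}\sum_{d\mid\frac{\phi(p^m)}{2}}\phi\!\left(\frac{\phi(p^m)}{2d}\right)\left(2^d-1\right)\prod_{k=1}^{m-1}2^{g_k(d)}.$$ Here $\phi$ is Euler's totient function and an empty product equals $1$.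
   Context: For a finite group $\mathcal{A}$ with identity $e$, let $G(\mathcal{A})=\{\Omega\subseteq\mathcal{A}:\Omega^{-1}=\Omega,\ \langle\Omega\rangle=\mathcal{A},\ e\notin\Omega\}$. $\mathrm{Aut}(\mathcal{A})$ acts on $G(\mathcal{A})$ by $\alpha\cdot\Omega=\alpha(\Omega)$. For $k\ge1$ let $a^w_k(\mathcal{A})$ be the number of orbits of $\mathrm{Aut}(\mathcal{A})$ on $\{\Omega\in G(\mathcal{A}):|\Omega|=k\}$ (the number of weak equivalence classes of Cayley graphs $C(\mathcal{A},\Omega)$ of degree $k$); $\Psi^w_{\mathcal{A}}(x)=\sum_{k=1}^{|\mathcal{A}|-1}a^w_k(\mathcal{A})x^k$ and $\mathcal{E}^w(\mathcal{A})=\Psi^w_{\mathcal{A}}(1)$. For cyclic groups $\mathbb{Z}_n$, $\mathrm{Aut}(\mathbb{Z}_n)$ consists of multiplications by units mod $n$. *)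

(* Defs.v *)
From HB Require Import structures.
From mathcomp Require Import all_boot all_order all_fingroup all_algebra.
Set Implicit Arguments. Unset Strict Implicit. Unset Printing Implicit Defensive.
Import GRing.Theory.

(* Cayley connection sets of Z_n (for n >= 2, 'Z_n is Z/nZ):
   Omega closed under negation, generating the additive group, 0 notin Omega. *)
Definition cayley_sets (n : nat) : {set {set 'Z_n}} :=
  [set S : {set 'Z_n} | [&& [forall x, (x \in S) ==> ((- x)%R \in S)],
                            (<<S>>%g == [set: 'Z_n]) & (0%R \notin S)]].

Definition cayley_sets_k (n k : nat) : {set {set 'Z_n}} :=
  [set S in cayley_sets n | #|S| == k].

(* Aut(Z_n) = multiplications by units *)
Definition Zn_units (n : nat) : {set 'Z_n} := [set u : 'Z_n | u \is a GRing.unit].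

Definition unit_orbit (n : nat) (S : {set 'Z_n}) : {set {set 'Z_n}} :=
  [set [set (u * x)%R | x in S] | u in Zn_units n].

Definition aw (n k : nat) : nat :=
  #|[set unit_orbit S | S in cayley_sets_k n k]|.

Definition Psi_w (n : nat) : {poly rat} :=
  (\sum_(1 <= k < n) (aw n k)%:R *: 'X^k)%R.

Definition E_w (n : nat) : nat := \sum_(1 <= k < n) aw n k.

Definition g_k (p m k d : nat) : nat := gcdn d (totient (p ^ (m - k)) %/ 2).

(* Main.v *)
(** Burnside's lemma, weighted by [X ^ #|S|], is applied to the cyclic unit
    group U = <g> of Z/p^m acting on the connection sets.  With M = phi(p^m)/2
    one has -1 = g^M, so a symmetric set is fixed by g^i iff it is invariant
    under g^d, where d = gcd(i, M); each d | M arises from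
    2 phi(M/d) exponents i < 2M.
    Sets invariant under <g^d> are unions of its orbits.  The nonzero residues
    split into levels (exact divisibility by p^k), on each of which U is
    transitive, so level k consists of g_k(d) orbits of <g^d> of equal size.
    A set generates Z/p^m iff it contains a unit, and removing the sets that
    avoid level 0 accounts for the term -1. *)
Require Import Defs.
From HB Require Import structures.
From mathcomp Require Import all_boot all_order all_fingroup all_algebra.
From mathcomp Require Import all_solvable.
Import GRing.Theory.

(** * Exponents grouped by their gcd with the modulus *)

(** The indices counted are the [j * d] with [j < n %/ d] coprime to [n %/ d]. *)
Lemma count_gcd_eq (n d : nat) : 0 < n -> d %| n ->
  \sum_(i < n | gcdn i n == d) 1 = totient (n %/ d).
Proof.
move=> n_gt0 /dvdnP[e def_n]; move: n_gt0; rewrite {n}def_n muln_gt0.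
case: e => // e /= d_gt0; rewrite mulnK // totient_count_coprime big_mkord.
have lt_h (j : 'I_e.+1) : j * d < e.+1 * d by rewrite ltn_pmul2r.
pose h j : 'I_(e.+1 * d) := Ordinal (lt_h j).
rewrite big_mkcond /= [RHS](eq_bigr (fun j : 'I_e.+1 =>
  if gcdn (h j) (e.+1 * d) == d then 1 else 0)); last first.
  move=> j _; rewrite /= -muln_gcdl -{2}[d]mul1n eqn_pmul2r //.
  by rewrite /coprime gcdnC; case: eqP.
rewrite -!big_mkcond /= (reindex_onto h (fun i => inord (i %/ d))) /=.
  by apply: eq_bigl => j; rewrite mulnK // inord_val eqxx andbT.
move=> i /eqP gcd_i; apply: val_inj => /=.
have dvd_i: d %| i by have := dvdn_gcdl i (e.+1 * d); rewrite gcd_i.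
by rewrite inordK ?divnK // ltn_divLR.
Qed.

Lemma sum_gcd (V : nmodType) (F : nat -> V) (n : nat) : 0 < n ->
  (\sum_(i < n) F (gcdn i n)
    = \sum_(d <- divisors n) F d *+ totient (n %/ d))%R.
Proof.
move=> n_gt0.
transitivity (\sum_(i < n) \sum_(d <- divisors n | gcdn i n == d) F d)%R.
  apply: eq_bigr => i _; under eq_bigl do rewrite eq_sym.
  rewrite -big_filter filter_pred1_uniq ?big_seq1 ?divisors_uniq //.
  by rewrite -dvdn_divisors // dvdn_gcdr.
rewrite (exchange_big_dep predT) //= big_seq [RHS]big_seq.
apply: eq_bigr => d; rewrite -dvdn_divisors // => dvd_d.
by rewrite -(@count_gcd_eq n d) // sum1_card sumr_const.
Qed.

(** * Generating functions of unions of blocks and of invariant sets *)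

(** The condition on [S] says that it is a union of blocks. Expanding the product chooses a set [J]
    of blocks, and [J] is recovered from [cover J] because blocks are disjoint and nonempty. *)
Lemma sum_partition_unions (R : comNzRingType) (x : R) (T : finType)
    (P : {set {set T}}) (D : {set T}) : partition P D ->
  (\sum_(S : {set T} | cover [set B in P | B \subset S] == S) x ^+ #|S|
     = \prod_(B in P) (1 + x ^+ #|B|))%R.
Proof.
move=> /and3P[_ tiP P0]; pose blocks (S : {set T}) := [set B in P | B \subset S].
have coverK (J : {set {set T}}) : J \subset P -> blocks (cover J) = J.
  move=> /subsetP sJP; apply/setP=> B; rewrite !inE; apply/andP/idP; last first.
    by move=> JB; rewrite sJP // bigcup_sup.
  case=> PB /subsetP sBJ.
  have /set0Pn[y By]: B != set0 by apply: contraNneq P0 => <-.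
  have /bigcupP[C JC Cy] := sBJ y By.
  by rewrite -(def_pblock tiP PB By) (def_pblock tiP (sJP _ JC) Cy).
(* The product is extended to all subsets [B] of [T], with weight 0 off [P], so that after expansion
   any [J] not inside [P] contributes nothing. *)
rewrite [RHS]big_mkcond /= [RHS](eq_bigr (fun B =>
  (if B \in P then x ^+ #|B| else 0) + 1)%R); last first.
  by move=> B _; case: ifP; rewrite ?add0r // addrC.
rewrite bigA_distr [RHS](bigID (fun J : {set {set T}} => J \subset P)) /=.
rewrite [X in (_ + X)%R]big1 ?addr0.
  rewrite [RHS](reindex_onto blocks cover) /=; last by move=> J; apply: coverK.
  apply: eq_big => S.
    rewrite andb_idl // => _; apply/subsetP=> B; by rewrite inE => /andP[].
  move=> /eqP covS; have sSP: blocks S \subset P.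
    by apply/subsetP=> B; rewrite inE => /andP[].
  rewrite -{1}covS -(eqnP (trivIsetS sSP tiP)) -prodrXr [LHS]big_mkcond /=.
  by apply: eq_bigr => B _; case: ifP => // /(subsetP sSP) ->.
move=> J /subsetPn[B JB PB].
by rewrite (bigD1 B) //= JB (negPf PB) mul0r.
Qed.

(** An invariant set is the union of the orbits it contains, and the orbits partition [D]. *)
Lemma sum_invariant_sets (R : comNzRingType) (x : R) (aT : finGroupType)
    (T : finType) (to : {action aT &-> T}) (H : {group aT}) (D : {set T}) :
    [acts H, on D | to] ->
  (\sum_(S : {set T} | (S \subset D) && [acts H, on S | to]) x ^+ #|S|
     = \prod_(B in orbit to H @: D) (1 + x ^+ #|B|))%R.
Proof.
move=> actsD; have parD := orbit_partition actsD.
rewrite -(sum_partition_unions _ x _ _ _ parD); apply: eq_bigl => S.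
apply/andP/eqP=> [[sSD actsS] | covS].
  apply/eqP; rewrite eqEsubset; apply/andP; split.
    by apply/bigcupsP=> B; rewrite inE => /andP[].
  apply/subsetP=> y Sy; apply/bigcupP; exists (orbit to H y); last exact: orbit_refl.
  by rewrite inE imset_f ?(subsetP sSD) ?acts_sub_orbit.
split.
  rewrite -covS -[X in _ \subset pred_of_set X](cover_partition parD); apply/bigcupsP=> B.
  by rewrite inE => /andP[PB _]; apply: bigcup_sup.
apply/actsP=> a Ha y.
have closed z b : b \in H -> z \in S -> to z b \in S.
  rewrite -covS => Hb /bigcupP[B defB Bz]; apply/bigcupP; exists B => //.
  move: defB; rewrite inE => /andP[/imsetP[w _ defB] _]; move: Bz; rewrite defB => Bz.
  by rewrite -(orbit_eqP Bz) mem_orbit.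
apply/idP/idP; last exact: closed.
by move/(closed _ a^-1%g); rewrite actK; apply; rewrite groupV.
Qed.

(** * Orbits of subgroups of a cyclic group *)

(** [G] has a subgroup of order [gcdn #|H| #|K|]; in a cyclic group divisibility of orders implies
    inclusion, so it lies in both [H] and [K]. *)
Lemma card_cyclic_setI (gT : finGroupType) (G H K : {group gT}) :
  cyclic G -> H \subset G -> K \subset G -> #|H :&: K| = gcdn #|H| #|K|.
Proof.
move=> cycG sHG sKG; have [g defG] := cyclicP cycG.
apply/eqP; rewrite eqn_dvd dvdn_gcd !cardSg ?subsetIl ?subsetIr //=.
set t := gcdn _ _; have dvd_t : t %| #[g]%g.
  by rewrite orderE -defG (dvdn_trans (dvdn_gcdl _ _)) ?cardSg.
have oL : #|<[g ^+ (#[g] %/ t)]>%g| = t.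
  by rewrite -orderE orderXdiv ?dvdn_div // divnA // mulKn.
have sLG : <[g ^+ (#[g] %/ t)]>%g \subset G by rewrite defG cycleX.
rewrite -{1}oL; apply: cardSg; rewrite subsetI.
by apply/andP; split; rewrite -(cardSg_cyclic cycG) // oL ?dvdn_gcdl ?dvdn_gcdr.
Qed.

(** The stabiliser of [x] in [<[g ^+ d]>] is an intersection of two subgroups of [<[g]>], so
    [card_cyclic_setI] gives its order and orbit-stabiliser the orbit size. *)
Lemma card_orbit_cycleX (aT : finGroupType) (T : finType)
    (to : {action aT &-> T}) (g : aT) (d : nat) (x : T) :
    d %| #[g]%g ->
  #|orbit to <[g ^+ d]> x| * gcdn d #|orbit to <[g]> x| = #|orbit to <[g]> x|.
Proof.
move=> dvd_d; set s := #|orbit to <[g]> x|.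
have st := card_orbit_stab to <[g]> x; rewrite -/s -orderE in st.
have := card_orbit_stab to <[g ^+ d]> x.
set r := #|orbit _ <[g ^+ d]> x|.
have -> : ('C_<[g ^+ d]>[x | to] = <[g ^+ d]> :&: 'C_<[g]>[x | to])%g.
  by rewrite setIA (setIidPl (cycleX _ _)).
rewrite (card_cyclic_setI _ _ _ _ (cycle_cyclic g)) ?cycleX ?subsetIl //.
rewrite -orderE orderXdiv //.
set t := #|_| in st *; have := divnK dvd_d; set e := _ %/ d => de re.
have t_gt0 : 0 < t by rewrite cardG_gt0.
have d_gt0 : 0 < d by rewrite (dvdn_gt0 (order_gt0 g)).
have e_gt0 : 0 < e by rewrite divn_gt0 // dvdn_leq.
have gt0 : 0 < gcdn e t by rewrite gcdn_gt0 t_gt0 orbT.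
(* After multiplication by [gcdn e t] both sides equal [s * gcdn e t], because [e * d = s * t]. *)
apply/eqP; rewrite -(eqn_pmul2r gt0) mulnAC re muln_gcdr de -st.
by rewrite muln_gcdr mulnC gcdnC (mulnC e).
Qed.

(** * The unit group modulo an odd prime power *)

Lemma unit_actionE (R : finUnitRingType) (x : R) (u : {unit R}) :
  ('U%act x u = x * val u)%R.
Proof. by []. Qed.

Lemma prime_expn_gt1 (p m : nat) : prime p -> 0 < m -> 1 < p ^ m.
Proof. by move=> p_pr m_gt0; rewrite -(exp1n m) ltn_exp2r ?prime_gt1. Qed.

Lemma units_Zp_pfactor_cyclic (p m : nat) : prime p -> odd p -> 0 < m ->
  cyclic (units_Zp (p ^ m)).
Proof.
move=> p_pr p_odd m_gt0; have n_gt1 := prime_expn_gt1 p m p_pr m_gt0.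
have oa : #[Zp1 : 'Z_(p ^ m)]%g = p ^ m by rewrite order_Zp1 Zp_cast.
(* The isomorphism concerns units modulo [#[a]]; a variable [N] avoids rewriting that order inside a
   dependent type. *)
have cyc_units (gT : finGroupType) (a : gT) N :
    #[a]%g = N -> cyclic (Aut <[a]>) -> cyclic (units_Zp N).
  by move=> <-; rewrite (isog_cyclic (Zp_unit_isog a)).
apply: (cyc_units _ _ _ oa).
have pG : (p.-group <[Zp1 : 'Z_(p ^ m)]>)%g by rewrite /pgroup -orderE oa pnatX pnat_id.
have ntG : <[Zp1 : 'Z_(p ^ m)]>%g != 1%g by rewrite -cardG_gt1 -orderE oa.
have /= [f [_ [_ cycF _ _]]] := cyclic_pgroup_Aut_structure pG (cycle_cyclic _) ntG.
(* In order [p] the automorphism group is its own cyclic p'-core; for higher powers the structure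
   theorem gives cyclicity since [p] is odd. *)
case: ifP => [_ defA | _ [t [_ _ _]]]; last by rewrite p_odd => -[[]].
by have:= cycF; rewrite /= -defA.
Qed.

(** As [p ^ m > 2], [-1] differs from 1 and squares to 1; the only element of order 2 in a cyclic
    group is the half power of a generator. *)
Lemma units_Zp_generator (p m : nat) : prime p -> odd p -> 0 < m ->
  exists g : {unit 'Z_(p ^ m)},
    [/\ units_Zp (p ^ m) = <[g]>%g, #[g]%g = totient (p ^ m)
      & (val (g ^+ (totient (p ^ m) %/ 2))%g = -1)%R].
Proof.
move=> p_pr p_odd m_gt0; have n_gt1 := prime_expn_gt1 p m p_pr m_gt0.
have n_gt2 : 2 < p ^ m.
  rewrite ltn_neqAle n_gt1 andbT; apply: contraTneq p_odd => n2.
  by rewrite -[odd p]orbF -(gtn_eqF m_gt0) orbC -oddX -n2.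
have [g defU] := cyclicP (units_Zp_pfactor_cyclic p m p_pr p_odd m_gt0).
have og : #[g]%g = totient (p ^ m) by rewrite orderE -defU card_units_Zp // ltnW.
exists g; split => //; rewrite -og.
pose w : {unit 'Z_(p ^ m)} :=
  @FinRing.Unit 'Z_(p ^ m) _ (unitrN1 'Z_(p ^ m)).
suff -> : (g ^+ (#[g] %/ 2) = w)%g by [].
have gw : w \in <[g]>%g by rewrite -defU inE.
have [j lt_j def_w] := cyclePmin gw.
have w_neq1 : w != 1%g.
  apply/eqP=> /(congr1 val) /= /eqP; rewrite eq_sym -subr_eq0 opprK -(natrD _ 1 1).
  by move=> /eqP /(congr1 (@nat_of_ord _)); rewrite val_Zp_nat // modn_small.
have w2 : (w ^+ 2 = 1)%g by apply: val_inj; rewrite /= mulrNN mulr1.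
move: w_neq1 w2; rewrite def_w -expgM => /eqP gj_neq1 /eqP.
(* [j * 2] is a multiple of [#[g]]: factor 0 would give [w = 1], factor 1 gives the claim, and a
   larger one contradicts [j < #[g]]. *)
rewrite -order_dvdn => /dvdnP[[|[|q]]].
- by move/eqP; rewrite muln_eq0 orbF => /eqP j0; rewrite j0 in gj_neq1.
- by rewrite mul1n => <-; rewrite mulnK.
move=> def_2j; move: lt_j; rewrite -(ltn_pmul2r (isT : 0 < 2)) def_2j mulnC.
by rewrite ltn_pmul2l ?order_gt0.
Qed.

(** * Residues sorted by the exact power of [p] dividing them *)

(** For [0 < m], [k = 0] gives all nonzero residues and [k = 1] the nonzero non-units; excluding 0
    makes the chain end in the empty set at [k = m]. *)
Definition multiples (p m k : nat) : {set 'Z_(p ^ m)} :=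
  [set x : 'Z_(p ^ m) | (x != 0%R) && (p ^ k %| x)].

(* Meant for [k < m]: since [gcdn 0 n = n], [level p m m] is [{0}]. *)
Definition level (p m k : nat) : {set 'Z_(p ^ m)} :=
  [set x : 'Z_(p ^ m) | gcdn x (p ^ m) == p ^ k].

Lemma multiples_max (p m : nat) : 1 < p ^ m -> multiples p m m = set0.
Proof.
move=> n_gt1; apply/setP=> x; rewrite !inE; apply/negP=> /andP[x_neq0].
have ltx : x < p ^ m by rewrite -{2}(Zp_cast n_gt1).
by rewrite /dvdn modn_small // => /eqP x0; case/eqP: x_neq0; apply: val_inj.
Qed.

Lemma multiplesS (p m k : nat) : prime p -> k < m ->
  multiples p m k = level p m k :|: multiples p m k.+1.
Proof.
move=> p_pr lt_km; apply/setP=> x; rewrite !inE.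
have [-> | x_neq0] /= := eqVneq x 0%R.
  by rewrite gcd0n eqn_exp2l ?prime_gt1 // gtn_eqF.
apply/idP/orP=> [/dvdnP[y def_x] |
    [/eqP <- | /(dvdn_trans (dvdn_exp2l p (leqnSn k)))//]]; last first.
  exact: dvdn_gcdl.
(* With [x = y * p ^ k], either [p] divides [y] or the gcd of [x] with [p ^ m] is exactly
   [p ^ k]. *)
have [dvd_y | ndvd_y] := boolP (p %| y); [right | left].
  by rewrite def_x expnS dvdn_mul.
rewrite def_x -{1}(subnK (ltnW lt_km)) expnD -muln_gcdl.
suff -> : gcdn y (p ^ (m - k)) = 1 by rewrite mul1n.
by apply/eqP; rewrite -/(coprime _ _) coprime_sym coprimeXl ?prime_coprime.
Qed.

Lemma level_multiplesS_disjoint (p m k : nat) : prime p -> k < m ->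
  [disjoint level p m k & multiples p m k.+1].
Proof.
move=> p_pr lt_km; apply/pred0P=> x /=; rewrite !inE.
apply/negP=> /and3P[/eqP gcd_x _ dvd_x].
have : p ^ k.+1 %| p ^ k by rewrite -gcd_x dvdn_gcd dvd_x dvdn_exp2l.
by rewrite dvdn_Pexp2l ?prime_gt1 // ltnn.
Qed.

Lemma card_level (p m k : nat) : prime p -> k < m ->
  #|level p m k| = totient (p ^ (m - k)).
Proof.
move=> p_pr lt_km; have p_gt0 := prime_gt0 p_pr.
have n_gt1 := prime_expn_gt1 p m p_pr (leq_ltn_trans (leq0n k) lt_km).
have n_gt0 : 0 < p ^ m := ltnW n_gt1.
rewrite expnB ?(ltnW lt_km) //.
rewrite -(count_gcd_eq _ _ n_gt0 (dvdn_exp2l _ (ltnW lt_km))).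
have sumE N : N = p ^ m ->
    \sum_(i < p ^ m | gcdn i (p ^ m) == p ^ k) 1
      = \sum_(i < N | gcdn i (p ^ m) == p ^ k) 1.
  by move=> ->.
rewrite -sum1_card (sumE _ (Zp_cast n_gt1)).
by apply: eq_bigl => x; rewrite inE.
Qed.

(** If [x = y * p ^ k] is on level [k], then [p] does not divide [y], so [y] is a unit carrying
    [p ^ k] to [x]. *)
Lemma orbit_level (p m k : nat) : prime p -> k < m ->
  orbit 'U (units_Zp (p ^ m)) (p ^ k)%:R%R = level p m k.
Proof.
move=> p_pr lt_km; have m_gt0 := leq_ltn_trans (leq0n k) lt_km.
have n_gt1 := prime_expn_gt1 p m p_pr m_gt0.
have n_gt0 := ltnW n_gt1.
apply/setP=> x; rewrite [RHS]inE; apply/imsetP/idP=> [[u _ ->] | /eqP gcd_x].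
  rewrite unit_actionE; move: (val u) (valP u) => y uy.
  rewrite -[y]natr_Zp -natrM val_Zp_nat // gcdn_modl.
  have -> : gcdn (p ^ k * y) (p ^ m) = p ^ k * gcdn y (p ^ (m - k)).
    by rewrite muln_gcdr -expnD subnKC // ltnW.
  suff /eqP -> : coprime y (p ^ (m - k)) by rewrite muln1.
  rewrite coprimeXr // coprime_sym -(coprime_pexpl _ _ m_gt0).
  by rewrite -unitZpE // natr_Zp.
have /dvdnP[y def_x] : p ^ k %| x by rewrite -gcd_x dvdn_gcdl.
have uy : (y%:R : 'Z_(p ^ m))%R \is a GRing.unit.
  rewrite unitZpE // coprime_pexpl ?(leq_ltn_trans _ lt_km) // prime_coprime //.
  apply/negP=> dvd_y; have : p ^ k.+1 %| p ^ k.
    by rewrite -gcd_x dvdn_gcd dvdn_exp2l // def_x expnS dvdn_mul.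
  by rewrite dvdn_Pexp2l ?prime_gt1 // ltnn.
exists (FinRing.Unit uy); rewrite ?inE // unit_actionE /=.
by rewrite -natrM mulnC -def_x natr_Zp.
Qed.

(** * Weighted Burnside count and sums over a cyclic group *)

Lemma set_actionE (aT : finGroupType) (T : finType) (to : {action aT &-> T})
    (S : {set T}) (a : aT) : ((to^*)%act S a = [set to x a | x in S])%g.
Proof. by []. Qed.

Lemma setact_eqE (aT : finGroupType) (T : finType) (to : {action aT &-> T})
    (S : {set T}) (a : aT) : ((to^*)%act S a == S) = (a \in 'N(S | to)%g).
Proof.
apply/eqP/idP=> [toS | /astabs_setact //]; apply/astabsP=> x.
by rewrite -{1}toS set_actionE (mem_imset _ _ (act_inj to a)).
Qed.

(** The action preserves cardinality, so the Frobenius-Cauchy count applies to each size [k]; after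
    exchanging sums, [S] survives only at [k = #|S|], which the bounds keep in range. *)
Lemma weighted_Burnside (R : comNzRingType) (aT : finGroupType) (T : finType)
    (to : {action aT &-> T}) (G : {group aT}) (C : {set {set T}})
    (lo hi : nat) :
    [acts G, on C | to^*] -> {in C, forall S : {set T}, lo <= #|S| < hi} ->
  (\sum_(lo <= k < hi)
      (#|orbit to^* G @: [set S in C | #|S| == k]| * #|G|)%:R *: 'X^k
    = \sum_(a in G) \sum_(S in C | a \in 'N(S | to)%g) 'X^#|S| :> {poly R})%R.
Proof.
move=> actsC sizeC.
transitivity (\sum_(lo <= k < hi) \sum_(a in G)
    \sum_(S in C | (a \in 'N(S | to)%g) && (#|S| == k)) 'X^k : {poly R})%R.
  apply: eq_bigr => k _; rewrite -Frobenius_Cauchy; last first.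
    apply/actsP=> a Ga S; rewrite !inE card_setact; congr (_ && _).
    exact: (actsP actsC).
  rewrite natr_sum scaler_suml; apply: eq_bigr => a _.
  rewrite scaler_nat -sumr_const; apply: eq_bigl => S.
  rewrite inE [X in X && _]inE (sameP afix1P eqP) setact_eqE.
  by rewrite -andbA [(_ == k) && _]andbC.
rewrite exchange_big; apply: eq_bigr => a _ /=.
rewrite (exchange_big_dep (fun S => (S \in C) && (a \in 'N(S | to)%g))) /=; last first.
  by move=> k S _ /and3P[-> ->].
apply: eq_bigr => S /andP[CS NSa]; rewrite CS NSa /=.
under eq_bigl do rewrite eq_sym.
rewrite -big_filter filter_pred1_uniq ?big_seq1 ?iota_uniq //.
by rewrite mem_index_iota sizeC.
Qed.

Lemma unit_orbitE (n : nat) (S : {set 'Z_n}) :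
  unit_orbit S = orbit 'U^* (units_Zp n) S.
Proof.
apply/setP=> B; apply/imsetP/imsetP=> [[u] | [u _ ->]].
  rewrite inE => Uu ->; exists (FinRing.Unit Uu); rewrite ?inE // set_actionE.
  by apply: eq_imset => x; rewrite unit_actionE mulrC.
exists (val u); first by rewrite inE (valP u).
by rewrite set_actionE; apply: eq_imset => x; rewrite unit_actionE mulrC.
Qed.

Lemma big_cycle (V : nmodType) (gT : finGroupType) (g : gT) (F : gT -> V) :
  (\sum_(a in <[g]>%g) F a = \sum_(i < #[g]%g) F (g ^+ i)%g)%R.
Proof.
have injg : {in [set: 'I_#[g]%g] &, injective (fun i : 'I_#[g]%g => g ^+ i)%g}.
  move=> i j _ _ /eqP; rewrite eq_expg_mod_order !modn_small // => /eqP.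
  exact: val_inj.
transitivity (\sum_(a in [set (g ^+ nat_of_ord i)%g | i in [set: 'I_#[g]%g]]) F a)%R.
  apply: eq_bigl => a; apply/idP/imsetP=> [/cyclePmin[i lti ->] | [i _ ->]].
    by exists (Ordinal lti).
  exact: mem_cycle.
by rewrite big_imset //; apply: eq_bigl => i; rewrite inE.
Qed.

(** Used with [G] the stabiliser of a set and [g ^+ j = -1], to merge invariance under [g ^+ i] and
    under negation. *)
Lemma expg_gcd_group (gT : finGroupType) (G : {group gT}) (g : gT) (i j : nat) :
  (g ^+ gcdn i j \in G)%g = (g ^+ i \in G)%g && (g ^+ j \in G)%g.
Proof.
apply/idP/andP=> [Gg | [Gi Gj]].
  split; [have /dvdnP[k ->] := dvdn_gcdl i j | have /dvdnP[k ->] := dvdn_gcdr i j].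
    by rewrite mulnC expgM groupX.
  by rewrite mulnC expgM groupX.
have [-> | i_gt0] := posnP i; first by rewrite gcd0n.
(* Bezout without subtraction: [ki * i = kj * j + gcdn i j], hence the multiplication by a power of
   [g ^+ j]. *)
case: (egcdnP j i_gt0) => ki kj def_d _.
rewrite -(groupMl _ (groupX kj Gj)) -!expgM -expgD mulnC -def_d mulnC expgM.
exact: groupX.
Qed.

(** * Connection sets as invariant sets; the numbers [g_k] *)

(** The multiples of [p] form a proper subgroup, while a residue prime to [p] is a unit and so
    generates alone. *)
Lemma generates_pfactor (p m : nat) (S : {set 'Z_(p ^ m)}) : prime p -> 0 < m ->
  (<<S>>%g == [set: 'Z_(p ^ m)]) = ~~ (S \subset [set x : 'Z_(p ^ m) | p %| x]).
Proof.
move=> p_pr m_gt0; have n_gt1 := prime_expn_gt1 p m p_pr m_gt0.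
have dvd_mod y : (p %| y %% p ^ m) = (p %| y).
  by rewrite /dvdn modn_dvdm // -{1}(expn1 p) dvdn_exp2l.
apply/eqP/subsetPn=> [genS | [x Sx]].
  apply/subsetPn/negP=> sS.
  have K_group : group_set [set x : 'Z_(p ^ m) | p %| x].
    apply/group_setP; split=> [|x y]; rewrite !inE ?dvdn0 // => px py.
    by rewrite /= [X in _ %% X](Zp_cast n_gt1) dvd_mod dvdn_add.
  have: <<S>>%g \subset Group K_group by rewrite gen_subG.
  rewrite genS => /subsetP/(_ 1%R); rewrite !inE => /(_ isT).
  by rewrite /= dvdn1 gtn_eqF ?prime_gt1.
rewrite inE -prime_coprime // => px.
have ux : x \is a GRing.unit by rewrite -[x]natr_Zp unitZpE // coprime_pexpl.
apply/eqP; rewrite eqEsubset subsetT; apply/subsetP=> y _.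
suff -> : y = (x ^+ (x^-1 * y)%R)%g by rewrite groupX // mem_gen.
by rewrite FinRing.zmodXgE -mulr_natr natr_Zp mulVKr.
Qed.

(** Puts the three defining conditions in a form suited to orbit counting: symmetry becomes
    invariance under the unit [-1], and generation becomes meeting level 0. *)
Lemma mem_cayley_sets (p m : nat) (w : {unit 'Z_(p ^ m)})
    (S : {set 'Z_(p ^ m)}) :
    prime p -> 0 < m -> val w = (-1)%R ->
  (S \in cayley_sets (p ^ m))
    = [&& S \subset multiples p m 0, ~~ (S \subset multiples p m 1)
        & w \in 'N(S | 'U)%g].
Proof.
move=> p_pr m_gt0 val_w; rewrite inE generates_pfactor //.
have -> : (S \subset multiples p m 0) = (0%R \notin S).
  apply/subsetP/negP=> [sS /sS | S0 x Sx]; rewrite inE ?eqxx // dvd1n andbT.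
  by apply: contra_notN S0 => /eqP <-.
have -> : [forall x, (x \in S) ==> ((- x)%R \in S)] = (w \in 'N(S | 'U)%g).
  apply/forallP/astabsP=> symS x.
    rewrite unit_actionE val_w mulrN1; apply/idP/idP; last exact/implyP.
    by move=> Sx; rewrite -[x]opprK; apply: (implyP (symS _)).
  by apply/implyP=> Sx; have := symS x; rewrite unit_actionE val_w mulrN1 => ->.
have [S0 | _] := boolP (0%R \notin S); last by rewrite !andbF.
rewrite andbT andTb andbC; congr (~~ _ && _).
apply/subsetP/subsetP=> sS x Sx; have := sS x Sx.
  by rewrite !inE expn1 => ->; rewrite andbT; apply: contraNneq S0 => <-.
by rewrite !inE expn1 => /andP[].
Qed.

(* [totient (p ^ m)] is [totient (p ^ (m - k))] times the odd number [p ^ k], so a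
   divisor [d] of its half has fewer factors 2 than [totient (p ^ (m - k))]. *)
Lemma gcd_totient_half (p m k d : nat) : prime p -> odd p -> k < m ->
  d %| totient (p ^ m) %/ 2 -> gcdn d (totient (p ^ (m - k))) = g_k p m k d.
Proof.
move=> p_pr p_odd lt_km; rewrite /g_k.
have even_tot j : 0 < j -> totient (p ^ j) = (totient (p ^ j) %/ 2) * 2.
  move=> j_gt0; rewrite divnK // totient_pfactor // dvdn_mulr // dvdn2 -subn1.
  by rewrite oddB ?prime_gt0 // p_odd.
have -> : totient (p ^ m) = p ^ k * totient (p ^ (m - k)).
  rewrite !totient_pfactor ?subn_gt0 ?(leq_ltn_trans _ lt_km) // mulnCA -expnD.
  congr (_ * p ^ _); rewrite -!subn1 subnAC subnKC //.
  by rewrite subn1 -ltnS (ltn_predK lt_km).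
rewrite (even_tot (m - k)) ?subn_gt0 // [_ %/ 2 * 2 %/ 2]mulnK // mulnA mulnK //.
set s := _ %/ 2 => dvd_d.
apply/eqP; rewrite eqn_dvd !dvdn_gcd !dvdn_gcdl /=.
rewrite [X in _ && X](dvdn_trans (dvdn_gcdr _ _)) ?dvdn_mulr // andbT.
have def_s : gcdn (p ^ k * s) (s * 2) = s.
  rewrite [p ^ k * s]mulnC -muln_gcdr.
  suff /eqP -> : coprime (p ^ k) 2 by rewrite muln1.
  by rewrite coprimeXl // coprimen2.
rewrite -[X in _ %| X]def_s dvdn_gcd dvdn_gcdr andbT.
exact: dvdn_trans (dvdn_gcdl _ _) dvd_d.
Qed.

(** * Orbit products over the levels *)

Lemma acts_level (p m k : nat) (H : {group {unit 'Z_(p ^ m)}}) :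
  prime p -> k < m -> [acts H, on level p m k | 'U].
Proof.
move=> p_pr lt_km; apply: subset_trans (subsetT H) _.
by rewrite -orbit_level //; apply: acts_orbit; apply: subsetT.
Qed.

Lemma acts_multiples (p m k : nat) (H : {group {unit 'Z_(p ^ m)}}) :
  prime p -> 0 < m -> k <= m -> [acts H, on multiples p m k | 'U].
Proof.
move=> p_pr m_gt0 le_km; rewrite -(subKn le_km).
elim: (m - k) (leq_subr k m) => [_ | i IHi lt_im].
  rewrite subn0 multiples_max ?prime_expn_gt1 //.
  by apply/actsP=> u _ x; rewrite !inE.
have lt_m : m - i.+1 < m by rewrite ltn_subrL m_gt0.
rewrite multiplesS // subnSK //; apply: subset_trans (astabsU _ _ _).
by rewrite subsetI acts_level // IHi // ltnW.
Qed.

(** The level is a single orbit of [<[g]>], so [card_orbit_cycleX] gives every orbit of [<[g ^+ d]>]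
    in it the same size [s %/ c]; hence there are [c] of them. *)
Lemma level_orbits_prod (R : comNzRingType) (x : R) (p m k d : nat)
    (g : {unit 'Z_(p ^ m)}) :
    prime p -> odd p -> k < m -> units_Zp (p ^ m) = <[g]>%g ->
    d %| totient (p ^ m) %/ 2 -> d %| #[g]%g ->
  (\prod_(B in orbit 'U <[(g ^+ d)%g]> @: level p m k) (1 + x ^+ #|B|)
    = (1 + x ^+ (totient (p ^ (m - k)) %/ g_k p m k d)) ^+ g_k p m k d)%R.
Proof.
move=> p_pr p_odd lt_km defU dvd_d dvd_dg; have m_gt0 := leq_ltn_trans (leq0n k) lt_km.
have n_gt1 := prime_expn_gt1 p m p_pr m_gt0.
set c := g_k p m k d; set s := totient _.
have orbU := orbit_level p m k p_pr lt_km; rewrite defU in orbU.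
have c_gt0 : 0 < c.
  rewrite /c -gcd_totient_half // gcdn_gt0 totient_gt0 expn_gt0.
  by rewrite (prime_gt0 p_pr) orbT.
have cardB : {in orbit 'U <[(g ^+ d)%g]> @: level p m k,
    forall B : {set 'Z_(p ^ m)}, #|B| = s %/ c}.
  move=> _ /imsetP[y Ly ->]; have := card_orbit_cycleX _ _ 'U%act g d y dvd_dg.
  have -> : orbit 'U <[g]> y = level p m k.
    by rewrite -orbU in Ly *; apply/orbit_eqP.
  by rewrite card_level // gcd_totient_half // -/s -/c => <-; rewrite mulnK.
have acts_lev := acts_level p m k <[(g ^+ d)%g]> p_pr lt_km.
have := card_uniform_partition cardB (orbit_partition acts_lev).
rewrite card_level // -/s => def_s.
rewrite (eq_bigr (fun=> (1 + x ^+ (s %/ c))%R)); last by move=> B /cardB ->.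
rewrite prodr_const; congr (_ ^+ _)%R.
have s_gt0 : 0 < s by rewrite totient_gt0 expn_gt0 prime_gt0.
have dvd_c : c %| s by rewrite /c -gcd_totient_half // dvdn_gcdr.
have sc_gt0 : 0 < s %/ c by rewrite divn_gt0 // dvdn_leq.
by apply/eqP; rewrite -(eqn_pmul2r sc_gt0) -def_s mulnC divnK.
Qed.

(** Downward induction from the empty case [k = m], splitting off one level at a time. *)
Lemma multiples_orbits_prod (R : comNzRingType) (x : R) (p m k d : nat)
    (g : {unit 'Z_(p ^ m)}) :
    prime p -> odd p -> 0 < m -> k <= m -> units_Zp (p ^ m) = <[g]>%g ->
    d %| totient (p ^ m) %/ 2 -> d %| #[g]%g ->
  (\prod_(B in orbit 'U <[(g ^+ d)%g]> @: multiples p m k) (1 + x ^+ #|B|)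
    = \prod_(k <= j < m)
        (1 + x ^+ (totient (p ^ (m - j)) %/ g_k p m j d)) ^+ g_k p m j d)%R.
Proof.
move=> p_pr p_odd m_gt0 le_km defU dvd_d dvd_dg.
rewrite -(subKn le_km); elim: (m - k) (leq_subr k m) => [_ | i IHi lt_im].
  rewrite subn0 multiples_max ?prime_expn_gt1 //.
  by rewrite imset0 big_set0 big_geq.
have lt_m : m - i.+1 < m by rewrite ltn_subrL m_gt0.
rewrite multiplesS // big_ltn // -(level_orbits_prod _ _ _ _ _ _ g) //.
rewrite subnSK // -IHi ?(ltnW lt_im) // imsetU -bigU.
  by apply: eq_bigl => B; rewrite !inE.
(* An orbit common to both parts would lie in the invariant level and also meet its complement. *)
apply/pred0P=> B /=; apply/negP=> /andP[/imsetP[y Ly ->] /imsetP[z Mz orb_yz]].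
have : z \in level p m (m - i.+1).
  have acts_lev := acts_level _ _ _ <[(g ^+ d)%g]> p_pr lt_m.
  by rewrite -(acts_sub_orbit _ acts_lev) -orb_yz acts_sub_orbit.
move/(disjointFr (level_multiplesS_disjoint _ _ _ p_pr lt_m)).
by rewrite subnSK // Mz.
Qed.

(** Invariant sets of nonzero residues minus those without units: the two products differ by the
    level 0 factor, whose exponent is [d] itself. *)
Lemma sum_invariant_cayley_sets (p m d : nat) (g : {unit 'Z_(p ^ m)}) :
    prime p -> odd p -> 0 < m -> units_Zp (p ^ m) = <[g]>%g ->
    #[g]%g = totient (p ^ m) -> d %| totient (p ^ m) %/ 2 -> d %| #[g]%g ->
  (\sum_(S : {set 'Z_(p ^ m)} | [&& S \subset multiples p m 0,
          ~~ (S \subset multiples p m 1) & (g ^+ d)%g \in 'N(S | 'U)%g]) 'X^#|S|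
    = ((1 + 'X^(totient (p ^ m) %/ d)) ^+ d - 1) *
       \prod_(1 <= k < m)
          (1 + 'X^(totient (p ^ (m - k)) %/ g_k p m k d)) ^+ g_k p m k d
    :> {poly rat})%R.
Proof.
move=> p_pr p_odd m_gt0 defU og dvd_d dvd_dg.
have prodE k : k <= m -> (\sum_(S : {set 'Z_(p ^ m)} |
      (S \subset multiples p m k) && ((g ^+ d)%g \in 'N(S | 'U)%g)) 'X^#|S|
    = \prod_(k <= j < m)
    (1 + 'X^(totient (p ^ (m - j)) %/ g_k p m j d)) ^+ g_k p m j d :> {poly rat})%R.
  move=> le_km; rewrite -(multiples_orbits_prod _ _ _ _ _ _ g) //.
  rewrite -sum_invariant_sets ?acts_multiples //.
  by apply: eq_bigl => S; rewrite cycle_subG.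
have sub10 : multiples p m 1 \subset multiples p m 0.
  by apply/subsetP=> y; rewrite !inE dvd1n andbT => /andP[].
have g0 : g_k p m 0 d = d by rewrite /g_k subn0; apply/gcdn_idPl.
have := prodE 0 isT; rewrite big_ltn // g0 subn0 -prodE //.
rewrite (bigID (fun S : {set 'Z_(p ^ m)} => S \subset multiples p m 1)) /=.
rewrite mulrBl mul1r => <-; rewrite [X in (_ = X + _ - _)%R](_ : _ =
  \sum_(S : {set 'Z_(p ^ m)} | (S \subset multiples p m 1) &&
     ((g ^+ d)%g \in 'N(S | 'U)%g)) 'X^#|S|)%R.
  by rewrite addrC addKr; apply: eq_bigl => S; rewrite andbAC -andbA.
apply: eq_bigl => S; rewrite andbAC; congr (_ && _).
by apply: andb_idl => /subset_trans ->.
Qed.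

(** * Assembling the Burnside sum *)

Lemma aw_orbits (n k : nat) :
  aw n k = #|orbit 'U^* (units_Zp n) @: [set S in cayley_sets n | #|S| == k]|.
Proof. by congr #|pred_of_set _|; apply: eq_imset => S; apply: unit_orbitE. Qed.

Lemma acts_cayley_sets (p m : nat) : prime p -> 0 < m ->
  [acts units_Zp (p ^ m), on cayley_sets (p ^ m) | 'U^*].
Proof.
move=> p_pr m_gt0; pose w : {unit 'Z_(p ^ m)} :=
  @FinRing.Unit 'Z_(p ^ m) _ (unitrN1 'Z_(p ^ m)).
have mem_cay S : S \in cayley_sets (p ^ m) = _ :=
  mem_cayley_sets p m w S p_pr m_gt0 erefl.
apply/actsP=> u Uu S; rewrite !mem_cay.
have sub_mult k : k <= m ->
    (('U^*)%act S u \subset multiples p m k) = (S \subset multiples p m k).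
  move=> le_km.
  have actsM := acts_multiples p m k (units_Zp_group _) p_pr m_gt0 le_km.
  have nMu := actsP actsM u Uu; rewrite set_actionE.
  apply/subsetP/subsetP=> [sS x Sx | sS _ /imsetP[x Sx ->]].
    by rewrite -nMu; apply/sS/imsetP; exists x.
  by rewrite nMu sS.
rewrite !sub_mult //; congr [&& _, _ & _].
(* Units commute, so moving [S] by [u] does not affect its invariance under [w]. *)
by rewrite -!setact_eqE -!actM unit_Zp_mulgC actM (inj_eq (act_inj _ u)).
Qed.

Lemma card_cayley_set (p m : nat) (S : {set 'Z_(p ^ m)}) : prime p -> 0 < m ->
  S \in cayley_sets (p ^ m) -> 1 <= #|S| < p ^ m.
Proof.
move=> p_pr m_gt0; have n_gt1 := prime_expn_gt1 p m p_pr m_gt0.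
rewrite inE generates_pfactor // => /and3P[_ /subsetPn[x Sx _] S0].
rewrite card_gt0; apply/andP; split; first by apply/set0Pn; exists x.
have : S \proper [set: 'Z_(p ^ m)].
  by apply/properP; split; [exact: subsetT | exists 0%R].
move/proper_card; rewrite cardsT card_ord => /leq_trans; apply.
by rewrite Zp_cast.
Qed.

(** [gcdn i n] has period [n] in [i]. This is the source of the factor 2: exponents of [g] run below
    [2 * M], but the fixed sets depend only on the gcd with [M]. *)
Lemma sum_gcd_double (V : nmodType) (F : nat -> V) (n : nat) :
  (\sum_(i < n * 2) F (gcdn i n) = (\sum_(i < n) F (gcdn i n)) *+ 2)%R.
Proof.
rewrite muln2 -addnn big_split_ord mulr2n /=; congr (_ + _)%R.
by apply: eq_bigr => i _; rewrite gcdnC gcdnDl gcdnC.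
Qed.

Theorem theorem4p3 (p m : nat) (hp : prime p) (hodd : odd p) (hm : (1 <= m)%N) :
  Psi_w (p ^ m) =
    ((2%:R / (p ^ (m - 1) * (p - 1))%:R) *:
     \sum_(d <- divisors (totient (p ^ m) %/ 2))
        ((totient (totient (p ^ m) %/ (2 * d)))%:R *:
          (((1 + 'X^(totient (p ^ m) %/ d)) ^+ d - 1) *
           \prod_(1 <= k < m)
              (1 + 'X^(totient (p ^ (m - k)) %/ g_k p m k d)) ^+ g_k p m k d))
     : {poly rat})%R
  /\
  ((E_w (p ^ m))%:R =
    (2%:R / (p ^ (m - 1) * (p - 1))%:R) *
     \sum_(d <- divisors (totient (p ^ m) %/ 2))
        ((totient (totient (p ^ m) %/ (2 * d)))%:R * ((2 ^ d - 1)%N)%:R *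
         \prod_(1 <= k < m) ((2 ^ g_k p m k d)%N)%:R) :> rat)%R.
Proof.
set Psi_formula := (X in Psi_w _ = X /\ _).
have PsiE : Psi_w (p ^ m) = Psi_formula.
  have [g [defU og gM]] := units_Zp_generator p m hp hodd hm.
  have totE : p ^ (m - 1) * (p - 1) = totient (p ^ m).
    by rewrite totient_pfactor // !subn1 mulnC.
  have tot_gt0 : 0 < totient (p ^ m) by rewrite totient_gt0 expn_gt0 prime_gt0.
  have tot2 : totient (p ^ m) %/ 2 * 2 = totient (p ^ m).
    by rewrite divnK // -totE dvdn_mull // dvdn2 oddB ?prime_gt0 // hodd.
  rewrite /Psi_formula totE; set M := totient (p ^ m) %/ 2 in gM tot2 *.
  have M_gt0 : 0 < M by move: tot_gt0; rewrite -tot2 muln_gt0 andbT.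
  pose F d : {poly rat} := (((1 + 'X^(totient (p ^ m) %/ d)) ^+ d - 1) *
    \prod_(1 <= k < m)
       (1 + 'X^(totient (p ^ (m - k)) %/ g_k p m k d)) ^+ g_k p m k d)%R.
  have totPsi : ((totient (p ^ m))%:R *: Psi_w (p ^ m)
      = (\sum_(i < M) F (gcdn i M)) *+ 2)%R.
    rewrite -sum_gcd_double tot2 -og.
    transitivity (\sum_(1 <= k < p ^ m) (#|orbit 'U^* (units_Zp (p ^ m)) @:
        [set S in cayley_sets (p ^ m) | #|S| == k]| * #|units_Zp (p ^ m)|)%:R
        *: 'X^k : {poly rat})%R.
      rewrite scaler_sumr; apply: eq_bigr => k _.
      by rewrite scalerA -natrM mulnC aw_orbits defU orderE.
    rewrite weighted_Burnside ?acts_cayley_sets //; last first.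
      by move=> S; apply: card_cayley_set.
    rewrite (eq_bigl [in <[g]>%g]) => [|a]; last by rewrite /= -defU.
    rewrite big_cycle; apply: eq_bigr => i _.
    have dvd_M : gcdn i M %| M by apply: dvdn_gcdr.
    rewrite /F -(sum_invariant_cayley_sets p m (gcdn i M) g) //.
      apply: eq_bigl => S; rewrite (mem_cayley_sets p m (g ^+ M)%g) // expg_gcd_group.
      by rewrite -!andbA [X in [&& _, _ & X]]andbC.
    by apply: dvdn_trans dvd_M _; rewrite og -tot2 dvdn_mulr.
  have tot_neq0 : ((totient (p ^ m))%:R : rat) != 0%R.
    by rewrite Num.Theory.pnatr_eq0 -lt0n.
  apply: (scalerI tot_neq0); rewrite totPsi scalerA mulrC divfK // scaler_nat.
  (* Grouping by [d = gcdn i M] yields [totient (M %/ d)], the stated coefficient since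
     [totient (p ^ m) %/ (2 * d) = M %/ d]. *)
  congr (_ *+ _)%R; rewrite sum_gcd //; apply: eq_bigr => d _.
  by rewrite scaler_nat divnMA.
split=> //.
have -> : ((E_w (p ^ m))%:R = (Psi_w (p ^ m)).[1] :> rat)%R.
  rewrite /E_w /Psi_w natr_sum horner_sum; apply: eq_bigr => k _.
  by rewrite hornerZ hornerXn expr1n mulr1.
rewrite PsiE /Psi_formula hornerZ horner_sum; congr (_ * _)%R.
apply: eq_bigr => d _; rewrite hornerZ hornerM -mulrA; congr (_ * (_ * _))%R.
  by rewrite !hornerE expr1n natrB ?expn_gt0 // natrX.
rewrite horner_prod; apply: eq_bigr => k _.
by rewrite !hornerE expr1n natrX.
Qed.
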